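(* Let $f:[a,b]\to\mathbb{R}$ be a continuous $\Phi$-H\''older function. Then for any $n\in\mathbb{N}$ which is a multiple of $3$, $$\max\{f(a),f(b)\}-\frac{n}{2}\Phi\Big(\frac{b-a}{n}\Big)\leq\frac{1}{b-a}\mathcal{S}_{n}^{\frac{3}{8}}(f)\leq\min\{f(a),f(b)\}+\frac{n}{2}\Phi\Big(\frac{b-a}{n}\Big).$$
   Context: Let $a<b$ be real numbers. $\mathbb{N}$ denotes the set of positive integers and $\mathbb{R}_+$ the set of nonnegative reals. $\Phi:[0,b-a]\to\mathbb{R}_+$ is an arbitrary function (called the error function). A function $f:[a,b]\to\mathbb{R}$ is $\Phi$-monotone if $f(x)\leq f(y)+\Phi(y-x)$ for all $x,y\in[a,b]$ with $x<y$; it is $\Phi$-H\''older if both $f$ and $-f$ are $\Phi$-monotone, i.e. $|f(x)-f(y)|\leq\Phi(|y-x|)$ for all $x,y\in[a,b]$. For $n\in\mathbb{N}$ put $x_i=a+\frac{(b-a)i}{n}$, $i=0,1,\ldots,n$. For $n=3k$ with $k\in\mathbb{N}$, Simpson's $3/8$ rule is $$\mathcal{S}_{n}^{\frac{3}{8}}(f)=\frac{3(b-a)}{8n}\sum_{i=1}^{n/3}\Big[f(x_{3i-3})+3f(x_{3i-2})+3f(x_{3i-1})+f(x_{3i})\Big].$$ *)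

(* Defs.v *)
From HB Require Import structures.
From mathcomp Require Import all_boot all_order all_algebra.
From mathcomp Require Import all_classical all_reals all_analysis.
Set Implicit Arguments.
Unset Strict Implicit.
Unset Printing Implicit Defensive.
Import Order.TTheory GRing.Theory Num.Theory.
Import numFieldNormedType.Exports.
Local Open Scope ring_scope.

(* Real functions on [a, b] (resp. [0, b - a]) are encoded by total functions
   R -> R; every condition below only concerns their values on the interval. *)

Definition error_function (R : realType) (a b : R) (Phi : R -> R) : Prop :=
  forall t : R, t \in `[0, b - a] -> 0 <= Phi t.

Definition Phi_monotone (R : realType) (a b : R) (Phi f : R -> R) : Prop :=
  forall x y : R, x \in `[a, b] -> y \in `[a, b] -> x < y ->
    f x <= f y + Phi (y - x).

Definition Phi_Holder (R : realType) (a b : R) (Phi f : R -> R) : Prop :=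
  Phi_monotone a b Phi f /\ Phi_monotone a b Phi (fun x => - f x).

Definition node (R : realType) (a b : R) (n i : nat) : R :=
  a + (b - a) * i%:R / n%:R.

(* Meaningful when n is a positive multiple of 3. The indices use truncated
   subtraction on nat, which is exact here because 1 <= i. *)
Definition simpson38 (R : realType) (a b : R) (n : nat) (f : R -> R) : R :=
  3 * (b - a) / (8 * n%:R) *
  \sum_(1 <= i < (n %/ 3).+1)
    (f (node a b n (3 * i - 3)) + 3 * f (node a b n (3 * i - 2))
     + 3 * f (node a b n (3 * i - 1)) + f (node a b n (3 * i))).

(* Main.v *)
Require Import Defs.
From HB Require Import structures.
From mathcomp Require Import all_boot all_order all_algebra.
From mathcomp Require Import all_classical all_reals all_analysis.
From mathcomp Require Import ring lra zify.
Set Implicit Arguments.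
Unset Strict Implicit.
Unset Printing Implicit Defensive.
Import Order.TTheory GRing.Theory Num.Theory.
Import numFieldNormedType.Exports.
Local Open Scope classical_set_scope.
Local Open Scope ring_scope.

(** Consecutive nodes are at distance h = (b - a) / n, so one step along the
    grid changes f by at most P = Phi h.  Walking from a to the i-th node takes
    i steps and walking from there to b takes n - i, whence
      f (x_i) <= f a + i P   and   f (x_i) <= f b + (n - i) P
    ([le_node_left], [le_node_right]).  Both right-hand sides are affine in i.
    Simpson's 3/8 rule has nonnegative weights and integrates affine functions
    exactly, so the corresponding mean of an affine majorant c + d i is its
    value c + d n / 2 at the midpoint ([simpson38_mean_le_affine]); this equals
    f a + n P / 2 in the first case and f b + n P / 2 in the second.  The lower
    bounds are the upper bounds for - f, since the Hoelder condition is
    symmetric and the rule is odd in f. *)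

Lemma node0 (R : realType) (a b : R) (n : nat) : node a b n 0 = a.
Proof. by rewrite /node mulr0 mul0r addr0. Qed.

Lemma node_last (R : realType) (a b : R) (n : nat) :
  (0 < n)%N -> node a b n n = b.
Proof.
move=> n0; have nr0 : n%:R != 0 :> R by rewrite pnatr_eq0 -lt0n.
by rewrite /node mulfK// addrC subrK.
Qed.

Lemma nodeS_sub (R : realType) (a b : R) (n i : nat) :
  node a b n i.+1 - node a b n i = (b - a) / n%:R.
Proof. by rewrite /node -natr1; ring. Qed.

Lemma node_in (R : realType) (a b : R) (n i : nat) :
  a <= b -> (i <= n)%N -> node a b n i \in `[a, b].
Proof.
move=> ab; case: n => [|n] lein.
  by rewrite /node invr0 mulr0 addr0 in_itv /= lexx.
have n0 : 0 < n.+1%:R :> R by rewrite ltr0n.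
have ba0 : 0 <= b - a by rewrite subr_ge0.
rewrite in_itv /= /node lerDl divr_ge0 ?mulr_ge0//= -lerBrDl ler_pdivrMr//.
by rewrite ler_wpM2l// ler_nat.
Qed.

Lemma Phi_monotone_step (R : realType) (a b : R) (Phi f : R -> R) (n i : nat) :
  a < b -> Phi_monotone a b Phi f -> (i < n)%N ->
  f (node a b n i) <= f (node a b n i.+1) + Phi ((b - a) / n%:R).
Proof.
move=> ab monf ltin; rewrite -(nodeS_sub a b n i).
apply: monf; rewrite ?node_in ?(ltW ab) ?(ltnW ltin)//.
by rewrite -subr_gt0 nodeS_sub divr_gt0 ?subr_gt0 ?ltr0n ?(leq_ltn_trans _ ltin).
Qed.

Lemma le_node_left (R : realType) (a b : R) (Phi f : R -> R) (n i : nat) :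
  a < b -> Phi_monotone a b Phi (fun x => - f x) -> (i <= n)%N ->
  f (node a b n i) <= f a + i%:R * Phi ((b - a) / n%:R).
Proof.
move=> ab monNf; elim: i => [|i IHi] lein; first by rewrite node0 mul0r addr0.
have := Phi_monotone_step ab monNf lein; have := IHi (ltnW lein).
by rewrite -natr1; lra.
Qed.

Lemma le_node_right (R : realType) (a b : R) (Phi f : R -> R) (n i : nat) :
  a < b -> (0 < n)%N -> Phi_monotone a b Phi f -> (i <= n)%N ->
  f (node a b n i) <= f b + (n%:R - i%:R) * Phi ((b - a) / n%:R).
Proof.
move=> ab n0 monf lein; rewrite -natrB//.
(* Induction on the number of steps left before b. *)
rewrite -[X in node a b n X](subKn lein).
elim: (n - i)%N (leq_subr i n) => [|j IHj] lejn.
  by rewrite subn0 node_last// mul0r addr0.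
have ltn_n : (n - j.+1 < n)%N by lia.
have := Phi_monotone_step ab monf ltn_n; have := IHj (ltnW lejn).
by rewrite subnSK// -natr1; lra.
Qed.

Lemma simpson38N (R : realType) (a b : R) (n : nat) (f : R -> R) :
  simpson38 a b n (fun x => - f x) = - simpson38 a b n f.
Proof.
rewrite /simpson38 -mulrN -sumrN; congr (_ * _).
by apply: eq_bigr => i _; ring.
Qed.

(** The bound is the integral mean of the affine majorant: on the i-th block of
    three subintervals the weights 1, 3, 3, 1 applied to c + d j give
    8 c + (24 i - 12) d, and the sum of 24 i - 12 over the k = n / 3 blocks is
    12 k ^ 2. *)
Lemma simpson38_mean_le_affine (R : realType) (a b : R) (n : nat)
    (f : R -> R) (c d : R) :
  a < b -> (0 < n)%N -> (3 %| n)%N ->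
  (forall i, (i <= n)%N -> f (node a b n i) <= c + d * i%:R) ->
  (b - a)^-1 * simpson38 a b n f <= c + n%:R / 2 * d.
Proof.
move=> ab n0 /dvdnP[k nE] fle; rewrite /simpson38.
have ba0 : b - a != 0 by rewrite gt_eqF// subr_gt0.
have nr0 : n%:R != 0 :> R by rewrite pnatr_eq0 -lt0n.
have -> : (n %/ 3 = k)%N by rewrite nE mulnK.
set S := \sum_(_ <= _ < _) _.
have SE : S <= 8 * c * k%:R + 12 * d * k%:R ^+ 2.
  have : (k * 3 <= n)%N by rewrite nE.
  rewrite /S; elim: k {nE S} => [|k IHk] lekn.
    by rewrite big_nil !mulr0 expr0n mulr0 addr0.
  rewrite big_nat_recr//=.
  have -> : (3 * k.+1 - 3 = 3 * k)%N by lia.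
  have -> : (3 * k.+1 - 2 = 3 * k + 1)%N by lia.
  have -> : (3 * k.+1 - 1 = 3 * k + 2)%N by lia.
  have -> : (3 * k.+1 = 3 * k + 3)%N by lia.
  have := fle (3 * k)%N ltac:(lia); have := fle (3 * k + 1)%N ltac:(lia).
  have := fle (3 * k + 2)%N ltac:(lia); have := fle (3 * k + 3)%N ltac:(lia).
  have := IHk ltac:(lia).
  by rewrite !(natrD _ (3 * k)) natrM -natr1; lra.
have -> : (b - a)^-1 * (3 * (b - a) / (8 * n%:R) * S) = 3 / (8 * n%:R) * S.
  by field; rewrite nr0 ba0.
have -> : c + n%:R / 2 * d
    = 3 / (8 * n%:R) * (8 * c * k%:R + 12 * d * k%:R ^+ 2).
  move: nr0; rewrite nE natrM mulf_eq0 negb_or => /andP[k0 _].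
  by field; rewrite k0.
by rewrite ler_wpM2l// divr_ge0// mulr_ge0.
Qed.

Lemma simpson38_mean_le_min (R : realType) (a b : R) (Phi f : R -> R) (n : nat) :
  a < b -> Phi_Holder a b Phi f -> (0 < n)%N -> (3 %| n)%N ->
  (b - a)^-1 * simpson38 a b n f
    <= Num.min (f a) (f b) + n%:R / 2 * Phi ((b - a) / n%:R).
Proof.
move=> ab [monf monNf] n0 n3; set P := Phi _.
have le_a : (b - a)^-1 * simpson38 a b n f <= f a + n%:R / 2 * P.
  apply: simpson38_mean_le_affine => // i lein.
  by rewrite [P * _]mulrC; exact: le_node_left.
have le_b : (b - a)^-1 * simpson38 a b n f
    <= (f b + n%:R * P) + n%:R / 2 * (- P).
  apply: simpson38_mean_le_affine => // i lein.
  by have := le_node_right ab n0 monf lein; rewrite -/P; lra.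
by case: (leP (f a) (f b)) => _; lra.
Qed.

Theorem corollary5 (R : realType) (a b : R) (hab : a < b)
    (Phi : R -> R) (hPhi : error_function a b Phi)
    (f : R -> R) (hcont : {within `[a, b], continuous f})
    (hf : Phi_Holder a b Phi f)
    (n : nat) (hn : (0 < n)%N) (hn3 : (3 %| n)%N) :
  Num.max (f a) (f b) - n%:R / 2 * Phi ((b - a) / n%:R)
    <= (b - a)^-1 * simpson38 a b n f
  /\ (b - a)^-1 * simpson38 a b n f
    <= Num.min (f a) (f b) + n%:R / 2 * Phi ((b - a) / n%:R).
Proof.
split; last exact: simpson38_mean_le_min.
have hfN : Phi_Holder a b Phi (fun x => - f x).
  case: hf => monf monNf; split=> // x y xab yab ltxy.
  by rewrite !opprK; exact: monf.
have := simpson38_mean_le_min hab hfN hn hn3.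
by rewrite simpson38N mulrN -oppr_max; lra.
Qed.
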